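(* Let $k$ be an algebraically closed field, and let $\chi=\sum_{i=1}^n m_i\alpha_i$ be a regular dominant character of $T$ with $m_i\in\mathbb{N}$ and $m_{i+1}>m_i$ for $1\le i\le n-1$, where $T$ is a maximal torus of $SL_{n+1}(k)$ and $\alpha_1,\dots,\alpha_n$ are the simple roots with respect to a Borel subgroup $B_{n+1}$ of $GL_{n+1}(k)$ containing $T$. Then there is an isomorphism $$\Psi:\ {}_{T}\backslash\backslash \big(GL_{n+1}(k)/B_{n+1}\big)^{ss}(L_\chi)\ \stackrel{\sim}{\longrightarrow}\ GL_n(k)/B_n .$$
   Context: The simple roots $S=\{\alpha_1,\dots,\alpha_n\}$ are numbered in the order of the vertices of the Dynkin diagram of type $A_n$. A character $\chi$ is regular dominant if $\langle\chi,\check{\alpha}_i\rangle>0$ for all $i$. $L_\chi$ is the (ample, $T$-linearised) line bundle on $GL_{n+1}(k)/B_{n+1}$ associated with $\chi$; $(\cdot)^{ss}(L_\chi)$ is the set of semi-stable points for the action of $T$ with respect to $L_\chi$, and ${}_T\backslash\backslash(\cdot)^{ss}(L_\chi)$ is the corresponding GIT quotient. $GL_n(k)$ is viewed as a subgroup of $GL_{n+1}(k)$ via $g\mapsto \begin{pmatrix} g&0\\0&1\end{pmatrix}$, and $B_n=B_{n+1}\cap GL_n(k)$, a Borel subgroup of $GL_n(k)$ with set of simple roots $I=S\setminus\{\alpha_n\}$. *)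

(* Defs.v *)
From HB Require Import structures.
From Stdlib Require Import Relation_Operators.
From mathcomp Require Import all_boot all_order all_algebra.
From mathcomp Require Import generic_quotient all_classical topology.

Set Implicit Arguments.
Unset Strict Implicit.
Unset Printing Implicit Defensive.

Import GRing.Theory.

Local Open Scope classical_set_scope.
Local Open Scope quotient_scope.
Local Open Scope ring_scope.

(* Varieties over an algebraically closed field are treated classically: the
   topological space of closed points together with the sheaf of regular
   functions.  [reg U f] means that the restriction of f to the open set U is
   regular; the values of f outside U are irrelevant. *)
Record fspace (k : Type) := FSpace {
  fs_top :> topologicalType;
  reg : set fs_top -> (fs_top -> k) -> Prop }.

Definition morphism (k : Type) (X Y : fspace k) (F : X -> Y) : Prop :=
  continuous F /\
  forall (V : set Y) (f : Y -> k), open V -> reg V f ->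
    reg (F @^-1` V) (f \o F).

Definition isomorphism (k : Type) (X Y : fspace k) (F : X -> Y) : Prop :=
  morphism F /\
  exists G : Y -> X, [/\ morphism G, cancel F G & cancel G F].

(* The subspace on a subset A; only used when A is open, in which case the open
   subsets of A are open in X and the regular functions are those of X. *)
Definition open_fspace (k : Type) (X : fspace k) (A : set X) : fspace k :=
  @FSpace k (initial_topology (fun x : A => val x))
    (fun U f => exists2 F : X -> k,
       reg ((fun x : A => val x) @` U) F &
       forall x : A, U x -> f x = F (val x)).

Section QuotientSpace.
Variables (k : Type) (X : fspace k) (R : X -> X -> Prop).

Definition gen_equiv : rel X := fun x y => `[< clos_refl_sym_trans X R x y >].

Lemma gen_equiv_refl : reflexive gen_equiv.
Proof. by move=> x; apply/asboolP; exact: rst_refl. Qed.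

Lemma gen_equiv_sym : symmetric gen_equiv.
Proof.
by move=> x y; apply/asboolP/asboolP => h; exact: rst_sym.
Qed.

Lemma gen_equiv_trans : transitive gen_equiv.
Proof.
move=> y x z /asboolP hxy /asboolP hyz; apply/asboolP.
exact: (rst_trans X R x y z).
Qed.

Canonical gen_equiv_rel :=
  EquivRel gen_equiv gen_equiv_refl gen_equiv_sym gen_equiv_trans.

Definition quot_top : topologicalType :=
  quotient_topology {eq_quot gen_equiv_rel}.

Definition quot_proj (x : X) : quot_top := (\pi_{eq_quot gen_equiv_rel} x)%qT.

(* The quotient of X by the equivalence relation generated by R: quotient
   topology, and f is regular on U iff its pullback is regular on the preimage
   of U. *)
Definition quot_fspace : fspace k :=
  @FSpace k quot_top
    (fun U f => reg (quot_proj @^-1` U) (f \o quot_proj)).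

End QuotientSpace.

(* The polynomial functions of the entries of a matrix. *)
Inductive polyfun (k : fieldType) (N : nat) : ('M[k]_N -> k) -> Prop :=
| polyfun_const c : polyfun (fun=> c)
| polyfun_coord i j : polyfun (fun A => A i j)
| polyfun_add p q : polyfun p -> polyfun q -> polyfun (fun A => p A + q A)
| polyfun_mul p q : polyfun p -> polyfun q -> polyfun (fun A => p A * q A).

Record GL (k : fieldType) (N : nat) := GLmx {
  glmx :> 'M[k]_N;
  glmxP : glmx \in unitmx }.

Section GeneralLinear.
Variables (k : fieldType) (N : nat).

HB.instance Definition _ := [isSub for @glmx k N].
HB.instance Definition _ := [Choice of GL k N by <:].

Lemma mulGL_subproof (g h : GL k N) : g *m h \in unitmx.
Proof. by rewrite unitmx_mul (glmxP g) (glmxP h). Qed.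

Definition mulGL (g h : GL k N) : GL k N := GLmx (mulGL_subproof g h).

Lemma invGL_subproof (g : GL k N) : invmx g \in unitmx.
Proof. by rewrite unitmx_inv (glmxP g). Qed.

Definition invGL (g : GL k N) : GL k N := GLmx (invGL_subproof g).

(* The Zariski topology: the sets p <> 0, with p a polynomial, are a basis. *)
Definition zariski_open (U : set (GL k N)) : Prop :=
  forall g, U g -> exists p : 'M[k]_N -> k,
    [/\ polyfun p, p g != 0 & forall h : GL k N, p h != 0 -> U h].

Lemma zariski_openT : zariski_open setT.
Proof.
move=> g _; exists (fun=> 1); split => //; first exact: polyfun_const.
exact: oner_neq0.
Qed.

Lemma zariski_openI : setI_closed zariski_open.
Proof.
move=> U V oU oV g [/oU [p [pp pg pU]] /oV [q [qq qg qV]]].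
exists (fun A => p A * q A); split; first exact: polyfun_mul.
  by rewrite mulf_neq0.
by move=> h; rewrite mulf_eq0 negb_or => /andP[/pU ? /qV].
Qed.

Lemma zariski_open_bigU (I : Type) (U : I -> set (GL k N)) :
  (forall i, zariski_open (U i)) -> zariski_open (\bigcup_i U i).
Proof.
move=> oU g [i _ /oU [p [pp pg pU]]].
by exists p; split => // h /pU ?; exists i.
Qed.

HB.instance Definition _ :=
  isOpenTopological.Build (GL k N) zariski_openT zariski_openI
    zariski_open_bigU.

(* A function is regular on U if near each point of U it is a quotient of
   polynomials. *)
Definition regular_GL (U : set (GL k N)) (f : GL k N -> k) : Prop :=
  forall g, U g -> exists p q : 'M[k]_N -> k,
    [/\ polyfun p, polyfun q, q g != 0 &
        forall h : GL k N, U h -> q h != 0 -> f h = p h / q h].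

Definition GL_fspace : fspace k := @FSpace k (GL k N) regular_GL.

Definition GLmod (B : set (GL k N)) : fspace k :=
  @quot_fspace k GL_fspace (fun g h => exists2 b, B b & h = mulGL g b).

Definition GLmod_pi (B : set (GL k N)) (g : GL k N) : GLmod B :=
  @quot_proj k GL_fspace (fun g h => exists2 b, B b & h = mulGL g b) g.

End GeneralLinear.

Section GIT.
Variables (k : fieldType) (N : nat).
Variables (T B : set (GL k N)) (chi : GL k N -> k).

(* The global sections of the d-th power of L_chi.  With B the positive Borel
   subgroup, L_chi is the bundle GL x^B k_(-chi); this is the convention making
   L_chi ample for chi regular dominant: for B upper triangular, the minors on
   the first i columns satisfy f (g b) = omega_i(b) f(g). *)
Definition lb_section (d : nat) (f : GL k N -> k) : Prop :=
  @reg k (GL_fspace k N) setT f /\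
  forall g b, B b -> f (mulGL g b) = chi b ^+ d * f g.

Definition T_invariant (f : GL k N -> k) : Prop :=
  forall t g, T t -> f (mulGL t g) = f g.

(* For L_chi ample on the projective variety GL / B, the locus where a section
   does not vanish is automatically affine. *)
Definition semistable : set (GLmod B) :=
  [set x | exists (d : nat) (f : GL k N -> k),
     [/\ (0 < d)%N, lb_section d f, T_invariant f &
         exists2 g, GLmod_pi B g = x & f g != 0]].

Definition ss_fspace : fspace k := open_fspace semistable.

Definition ss_orbit (x : ss_fspace) : set ss_fspace :=
  [set y | exists t g, [/\ T t, GLmod_pi B g = val x &
                           GLmod_pi B (mulGL t g) = val y]].

(* The GIT quotient: two semistable points are identified iff the closures of
   their T-orbits in the semistable locus meet (by GIT this is already an
   equivalence relation), the topology is the quotient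
   topology, and the regular functions are the T-invariant regular functions
   upstairs (the functions on a preimage that descend). *)
Definition git_quotient : fspace k :=
  @quot_fspace k ss_fspace
    (fun x y => closure (ss_orbit x) `&` closure (ss_orbit y) !=set0).

End GIT.

Section TypeA.
Variables (k : fieldType) (n : nat).

(* The columns v_1, ..., v_(n+1) of P form an ordered basis of k^(n+1).  A
   maximal torus T of SL_(n+1), a Borel subgroup B of GL_(n+1) containing it and
   the numbering of the simple roots along the Dynkin diagram are given by such
   a basis, in which T is diagonal and B upper triangular, and
   alpha_i = epsilon_i - epsilon_(i+1). *)
Definition in_basis (P g : GL k (n + 1)) : GL k (n + 1) :=
  mulGL (mulGL (invGL P) g) P.

Definition torus (P : GL k (n + 1)) : set (GL k (n + 1)) :=
  [set t : GL k (n + 1) | \det t = 1 /\ is_diag_mx (in_basis P t)].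

Definition borel (P : GL k (n + 1)) : set (GL k (n + 1)) :=
  [set b : GL k (n + 1) | is_trig_mx (in_basis P b)^T].

(* The character of B (hence of T) of weight lambda, in the basis epsilon. *)
Definition character (P : GL k (n + 1)) (lambda : 'rV[int]_(n + 1))
    (b : GL k (n + 1)) : k :=
  \prod_(j < n + 1) (in_basis P b j j) ^ (lambda 0 j).

Definition simple_root (i : 'I_n) : 'rV[int]_(n + 1) :=
  \row_j ((j == i :> nat)%:R - (j == i.+1 :> nat)%:R).

(* The coroot of alpha_i = epsilon_i - epsilon_(i+1) is the difference of the
   dual basis vectors, so it has the same coordinates. *)
Definition coroot_pairing (lambda : 'rV[int]_(n + 1)) (i : 'I_n) : int :=
  \sum_(j < n + 1) lambda 0 j * simple_root i 0 j.

Definition regular_dominant (lambda : 'rV[int]_(n + 1)) : Prop :=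
  forall i : 'I_n, 0 < coroot_pairing lambda i.

Lemma embed_subproof (g : GL k n) :
  block_mx g 0 0 (1%:M : 'M[k]_1) \in unitmx.
Proof. by rewrite unitmxE det_ublock det1 mulr1 -unitmxE (glmxP g). Qed.

(* GL_n as a subgroup of GL_(n+1), the matrices being taken in the basis P. *)
Definition embed (P : GL k (n + 1)) (g : GL k n) : GL k (n + 1) :=
  mulGL (mulGL P (GLmx (embed_subproof g))) (invGL P).

Definition borel_n (P : GL k (n + 1)) : set (GL k n) :=
  [set g | borel P (embed P g)].

End TypeA.

(* Main.v *)
Require Import Defs.
From HB Require Import structures.
From Stdlib Require Import Relation_Operators.
From mathcomp Require Import all_boot all_order all_algebra.
From mathcomp Require Import ring zify.
From mathcomp Require Import generic_quotient all_classical topology.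

Set Implicit Arguments.
Unset Strict Implicit.
Unset Printing Implicit Defensive.

Import GRing.Theory.

Local Open Scope classical_set_scope.
Local Open Scope quotient_scope.
Local Open Scope ring_scope.

(** In coordinates adapted to the basis, write chi = (lambda_0, ...,
    lambda_n). Since the m_i increase and chi is dominant, lambda_0, ...,
    lambda_(n-1) are positive, and lambda_n is minus their sum
    ([weight_shape]). This makes semistability depend on one step of a flag
    F_1 < ... < F_n < k^(n+1) only: a flag is semistable iff its hyperplane
    F_n contains no vector of the basis, that is, iff the linear form phi
    defining F_n has no zero coordinate ([semistableP]).

    If F_n contains the basis vector e_j, act by the one-parameter subgroup
    which scales e_j: the flag has a limit as s tends to 0, and the value at g
    of an invariant section of weight d chi is a positive power s^(d lambda_p)
    times a function of s regular at s = 0, hence is zero ([unstable_vanish]).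
    Conversely, if no coordinate of phi is zero, the diagonal matrix with
    entries phi moves F_n to the hyperplane H of equation x_0 + ... + x_n = 0,
    and the flag to a flag in H, which projection to the first n coordinates
    identifies with k^n. The resulting matrix [red] of size n does not change
    under T, and multiplying g by an upper triangular matrix on the right
    multiplies [red] by an upper triangular matrix on the right. Monomials in
    the leading minors of C * red g, for C a constant matrix, and in the
    determinant of g are therefore T-invariant and homogeneous under the Borel
    subgroup, and dominance and the positivity of lambda_0, ..., lambda_(n-1)
    are what allows the exponents to be chosen such that the weight is chi
    ([minor_section_mulr]); with C inverse to red g it does not vanish at g.

    So T permutes the hyperplanes of semistable flags transitively, the
    stabiliser being the scalars, and the quotient consists of the full flags
    in H. Precisely, g |-> red g induces a morphism from the semistable locus
    to GL_n / B_n which is constant on T-orbits. Points of GL_n / B_n being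
    closed, it takes the same value on orbits whose closures meet
    ([orbit_closure_eq]), and descends to the GIT quotient. Its inverse is
    induced by [sec], which sends a flag of k^n to the corresponding flag in
    H, completed by H itself ([secGL_redGL], [redGL_secGL]). *)

(** * Quotients of spaces with functions *)

Section Quotients.
Variables (k : Type) (X : fspace k) (R : X -> X -> Prop).

Lemma quot_proj_surj (z : quot_fspace R) : exists x : X, quot_proj R x = z.
Proof.
by exists (repr (z : {eq_quot gen_equiv_rel R})); rewrite /quot_proj reprK.
Qed.

Lemma quot_projP (x y : X) :
  quot_proj R x = quot_proj R y <-> clos_refl_sym_trans X R x y.
Proof.
have eqP := @eqmodP X (gen_equiv_rel R) x y.
by split=> [xy|/asboolP xy]; [apply/asboolP; apply/eqP; exact: xy | exact/eqP].
Qed.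

Lemma quot_proj_rel (x y : X) : R x y -> quot_proj R x = quot_proj R y.
Proof. by move=> xy; apply/quot_projP; exact: rst_step. Qed.

(** The equivalence relation of the quotient is generated by R, so it is
    enough to check F on single R-steps. *)
Lemma quot_lift (S : Type) (F : X -> S) :
  (forall x y, R x y -> F x = F y) ->
  exists F' : quot_fspace R -> S, forall x, F' (quot_proj R x) = F x.
Proof.
move=> FR.
have FE x y : clos_refl_sym_trans X R x y -> F x = F y.
  by elim=> [? ? /FR|//|? ? _ ->|? ? ? _ -> _ ->].
exists (fun z => F (repr (z : {eq_quot gen_equiv_rel R}))) => x.
apply: FE; apply/quot_projP.
by rewrite /quot_proj reprK.
Qed.

Lemma quot_open (V : set (quot_fspace R)) :
  open V <-> open (quot_proj R @^-1` V).
Proof. by []. Qed.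

Lemma quot_proj_morphism : @morphism k X (quot_fspace R) (quot_proj R).
Proof. by split=> [|V f _ //]; apply/continuousP. Qed.

(** Universal property: open sets and regular functions of the quotient are by
    definition those whose pullbacks are. *)
Lemma quot_morphism (Y : fspace k) (F : quot_fspace R -> Y) :
  morphism (F \o quot_proj R) -> morphism F.
Proof.
move=> [/continuousP cF rF]; split.
  by apply/continuousP => V oV; apply/quot_open; exact: cF.
by move=> V f oV fV; exact: (rF V f oV fV).
Qed.

Lemma quot_point_closed (x : X) :
  closed [set y | clos_refl_sym_trans X R x y] ->
  closed [set quot_proj R x].
Proof.
move=> cx; rewrite -openC; apply/quot_open.
suff -> : quot_proj R @^-1` (~` [set quot_proj R x]) =
    ~` [set y | clos_refl_sym_trans X R x y] by rewrite openC.
apply/seteqP; split => y /= ny; last by move=> /esym /quot_projP.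
by move=> /quot_projP /esym.
Qed.

End Quotients.

Lemma comp_morphism (k : Type) (X Y Z : fspace k) (F : X -> Y) (G : Y -> Z) :
  morphism F -> morphism G -> morphism (G \o F).
Proof.
move=> [cF rF] [cG rG]; split.
  by move=> x; apply: continuous_comp; [exact: cF | exact: cG].
move=> V f oV fV; apply: (rF (G @^-1` V) (f \o G)); last exact: rG.
by move/continuousP: cG; apply.
Qed.

(** * Polynomial maps between general linear groups *)

Section Poly.
Variable k : fieldType.

Lemma polyfun_sum (N : nat) (I : Type) (r : seq I) (F : I -> 'M[k]_N -> k) :
  (forall i, polyfun (F i)) -> polyfun (fun A => \sum_(i <- r) F i A).
Proof.
move=> pF; elim: r => [|i r IH].
  rewrite (_ : (fun A => _) = fun=> 0); first exact: polyfun_const.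
  by apply/funext => A; rewrite big_nil.
rewrite (_ : (fun A => _) = fun A => F i A + \sum_(i <- r) F i A).
  exact: polyfun_add.
by apply/funext => A; rewrite big_cons.
Qed.

Lemma polyfun_prod (N : nat) (I : Type) (r : seq I) (F : I -> 'M[k]_N -> k) :
  (forall i, polyfun (F i)) -> polyfun (fun A => \prod_(i <- r) F i A).
Proof.
move=> pF; elim: r => [|i r IH].
  rewrite (_ : (fun A => _) = fun=> 1); first exact: polyfun_const.
  by apply/funext => A; rewrite big_nil.
rewrite (_ : (fun A => _) = fun A => F i A * \prod_(i <- r) F i A).
  exact: polyfun_mul.
by apply/funext => A; rewrite big_cons.
Qed.

Lemma polyfun_exp (N : nat) (p : 'M[k]_N -> k) (e : nat) :
  polyfun p -> polyfun (fun A => p A ^+ e).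
Proof.
move=> pp; elim: e => [|e IH]; first exact: polyfun_const.
rewrite (_ : (fun A => _) = fun A => p A * p A ^+ e); first exact: polyfun_mul.
by apply/funext => A; rewrite exprS.
Qed.

Definition polymap (N m n : nat) (F : 'M[k]_N -> 'M[k]_(m, n)) : Prop :=
  forall i j, polyfun (fun A => F A i j).

Lemma polymap_id (N : nat) : polymap (@id 'M[k]_N).
Proof. by move=> i j; exact: polyfun_coord. Qed.

Lemma polymap_const (N m n : nat) (C : 'M[k]_(m, n)) :
  polymap (fun _ : 'M[k]_N => C).
Proof. by move=> i j; exact: polyfun_const. Qed.

Lemma polymap_mul (N m n p : nat) (F : 'M[k]_N -> 'M[k]_(m, n))
    (G : 'M[k]_N -> 'M[k]_(n, p)) :
  polymap F -> polymap G -> polymap (fun A => F A *m G A).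
Proof.
move=> pF pG i j.
rewrite (_ : (fun A => _) = fun A => \sum_l F A i l * G A l j).
  by apply: polyfun_sum => l; exact: polyfun_mul.
by apply/funext => A; rewrite mxE.
Qed.

Lemma polymap_mul2 (N : nat) (C D : 'M[k]_N) :
  polymap (fun A => C *m A *m D).
Proof.
apply: polymap_mul; last exact: polymap_const.
by apply: polymap_mul; [exact: polymap_const | exact: polymap_id].
Qed.

Lemma polyfun_det (N m : nat) (F : 'M[k]_N -> 'M[k]_m) :
  polymap F -> polyfun (fun A => \det (F A)).
Proof.
move=> pF; rewrite /determinant; apply: polyfun_sum => s.
apply: polyfun_mul; first exact: polyfun_const.
by apply: polyfun_prod.
Qed.

Lemma polymap_adj (N m : nat) (F : 'M[k]_N -> 'M[k]_m) :
  polymap F -> polymap (fun A => \adj (F A)).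
Proof.
move=> pF i j.
rewrite (_ : (fun A => _) = fun A => (-1) ^+ (j + i) *
    \det (row' j (col' i (F A)))); last by apply/funext => A; rewrite mxE.
apply: polyfun_mul; first exact: polyfun_const.
apply: polyfun_det => a b.
rewrite (_ : (fun A => _) = fun A => F A (lift j a) (lift i b)) //.
by apply/funext => A; rewrite !mxE.
Qed.

Lemma polyfun_comp (N M : nat) (F : 'M[k]_N -> 'M[k]_M) (p : 'M[k]_M -> k) :
  polymap F -> polyfun p -> polyfun (p \o F).
Proof.
move=> pF; elim=> [c|i j|p1 p2 _ h1 _ h2|p1 p2 _ h1 _ h2].
- exact: polyfun_const.
- exact: pF.
- exact: polyfun_add.
- exact: polyfun_mul.
Qed.

Lemma polymap_comp (N M p q : nat) (F : 'M[k]_N -> 'M[k]_M)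
    (G : 'M[k]_M -> 'M[k]_(p, q)) :
  polymap F -> polymap G -> polymap (G \o F).
Proof. by move=> pF pG i j; exact: (polyfun_comp pF (pG i j)). Qed.

(** Along a curve with polynomial entries a polynomial function is a
    polynomial in the parameter, so its limit at a point of the curve is an
    evaluation. *)
Lemma polyfun_curve (N : nat) (H : 'M[{poly k}]_N) (p : 'M[k]_N -> k) :
  polyfun p ->
  exists Q : {poly k}, forall s, Q.[s] = p (\matrix_(i, j) (H i j).[s]).
Proof.
elim=> [c|i j|p1 p2 _ [Q1 h1] _ [Q2 h2]|p1 p2 _ [Q1 h1] _ [Q2 h2]].
- by exists c%:P => s; rewrite hornerC.
- by exists (H i j) => s; rewrite mxE.
- by exists (Q1 + Q2) => s; rewrite hornerD h1 h2.
- by exists (Q1 * Q2) => s; rewrite hornerM h1 h2.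
Qed.

(** Here F agrees with a polynomial map on U only: the maps of interest take
    invertible values only on an open set. *)
Lemma polymap_open (N M : nat) (U : set (GL k N)) (F : GL k N -> GL k M)
    (F0 : 'M[k]_N -> 'M[k]_M) (V : set (GL k M)) :
  polymap F0 -> zariski_open U -> (forall g, U g -> glmx (F g) = F0 g) ->
  zariski_open V -> zariski_open (U `&` F @^-1` V).
Proof.
move=> pF oU FE oV g [Ug /oV [p [pp pg pV]]].
have [q [qq qg qU]] := oU g Ug.
exists (fun A => p (F0 A) * q A); split.
- by apply: polyfun_mul qq; exact: (polyfun_comp pF).
- by rewrite mulf_neq0 // -FE.
- move=> h; rewrite mulf_eq0 negb_or => /andP[ph qh].
  have Uh := qU _ qh; split => //.
  by apply: pV; rewrite FE.
Qed.

Lemma polymap_regular (N M : nat) (U : set (GL k N)) (F : GL k N -> GL k M)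
    (F0 : 'M[k]_N -> 'M[k]_M) (V : set (GL k M)) (f : GL k M -> k) :
  polymap F0 -> (forall g, U g -> glmx (F g) = F0 g) ->
  regular_GL V f -> regular_GL (U `&` F @^-1` V) (f \o F).
Proof.
move=> pF FE rf g [Ug /rf [p [q [pp qq qg fpq]]]].
exists (p \o F0), (q \o F0); split; try exact: polyfun_comp.
- by rewrite /= -FE.
- by move=> h [Uh Vh]; rewrite /= -FE // => qh; rewrite fpq.
Qed.

Lemma polymap_morphism (N M : nat) (F : GL k N -> GL k M)
    (F0 : 'M[k]_N -> 'M[k]_M) :
  polymap F0 -> (forall g, glmx (F g) = F0 g) ->
  @morphism k (GL_fspace k N) (GL_fspace k M) F.
Proof.
move=> pF FE; split.
  apply/continuousP => V oV; rewrite -[_ @^-1` _]setTI.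
  by apply: (polymap_open pF (@zariski_openT _ _)).
move=> V f oV fV; rewrite -[F @^-1` _]setTI.
exact: (polymap_regular pF).
Qed.

Lemma regular_GL_ext (N : nat) (U : set (GL k N)) (f f' : GL k N -> k) :
  (forall g, U g -> f g = f' g) -> regular_GL U f -> regular_GL U f'.
Proof.
move=> ff rf g Ug; have [p [q [pp qq qg fpq]]] := rf g Ug.
by exists p, q; split => // h Uh qh; rewrite -ff // fpq.
Qed.

End Poly.

(** * Coset spaces of the general linear group and their open subspaces *)

Section Group.
Variables (k : fieldType) (N : nat).
Implicit Types (g h : GL k N).

Lemma GL_inj g h : glmx g = glmx h -> g = h.
Proof. exact: val_inj. Qed.

Lemma glmx_mul g h : glmx (mulGL g h) = g *m h.
Proof. by []. Qed.

Definition oneGL : GL k N := GLmx (unitmx1 k N).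

Lemma mulGLA g h l : mulGL g (mulGL h l) = mulGL (mulGL g h) l.
Proof. by apply: GL_inj; rewrite /= mulmxA. Qed.

Lemma mulGL1 g : mulGL g oneGL = g.
Proof. by apply: GL_inj; rewrite /= mulmx1. Qed.

Lemma mul1GL g : mulGL oneGL g = g.
Proof. by apply: GL_inj; rewrite /= mul1mx. Qed.

Lemma mulGLV g : mulGL g (invGL g) = oneGL.
Proof. by apply: GL_inj; rewrite /= mulmxV ?glmxP. Qed.

Lemma mulVGL g : mulGL (invGL g) g = oneGL.
Proof. by apply: GL_inj; rewrite /= mulVmx ?glmxP. Qed.

Definition subgroup (B : set (GL k N)) : Prop :=
  [/\ B oneGL, forall b c, B b -> B c -> B (mulGL b c) &
      forall b, B b -> B (invGL b)].

Lemma coset_equivP (B : set (GL k N)) g h : subgroup B ->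
  clos_refl_sym_trans (GL k N) (fun g h => exists2 b, B b & h = mulGL g b) g h
  <-> exists2 b, B b & h = mulGL g b.
Proof.
move=> [B1 BM BV]; split; last by move=> ?; exact: rst_step.
elim=> [//|x|x y _ [b Bb ->]|x y z _ [b Bb ->] _ [c Bc ->]].
- by exists oneGL => //; rewrite mulGL1.
- by exists (invGL b); [exact: BV | rewrite -mulGLA mulGLV mulGL1].
- by exists (mulGL b c); [exact: BM | rewrite mulGLA].
Qed.

Lemma GLmod_piP (B : set (GL k N)) g h : subgroup B ->
  GLmod_pi B g = GLmod_pi B h <-> exists2 b, B b & h = mulGL g b.
Proof.
move=> sB; rewrite -(coset_equivP g h sB).
exact: quot_projP.
Qed.

End Group.

Section ToGL.
Variables (k : fieldType) (N : nat).

(** Total, so that a matrix-valued map that is invertible only somewhere can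
    be composed with maps out of the group; the value elsewhere is the
    identity. *)
Definition toGL (M : 'M[k]_N) : GL k N := insubd (oneGL k N) M.

Lemma toGLK (M : 'M[k]_N) : M \in unitmx -> glmx (toGL M) = M.
Proof. by move=> uM; rewrite -[LHS]/(val (toGL M)) val_insubd uM. Qed.

Lemma GL_det_neq0 (g : GL k N) : \det g != 0.
Proof. by rewrite -unitfE -unitmxE glmxP. Qed.

End ToGL.

Lemma GLmod_pi_surj (k : fieldType) (N : nat) (B : set (GL k N)) (y : GLmod B) :
  exists g, GLmod_pi B g = y.
Proof.
by have [g <-] := @quot_proj_surj k (GL_fspace k N) _ y; exists g.
Qed.

Lemma open_GL (k : fieldType) (N : nat) (U : set (GL_fspace k N)) :
  open U <-> zariski_open U.
Proof. by []. Qed.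

Section OpenPart.
Variables (k : fieldType) (N : nat) (B : set (GL k N)) (A : set (GLmod B)).

(** An open part of the coset space has the quotient structure of its
    preimage, so that a map out of it is a morphism as soon as its lift r
    behaves like one on that preimage. *)
Lemma morphism_from_open (Y : fspace k) (F : open_fspace A -> Y)
    (r : GL k N -> Y) :
  (forall g (x : open_fspace A), GLmod_pi B g = val (x : A) -> F x = r g) ->
  (forall V : set Y, open V ->
     zariski_open (GLmod_pi B @^-1` A `&` r @^-1` V)) ->
  (forall (V : set Y) f, open V -> reg V f ->
     regular_GL (GLmod_pi B @^-1` A `&` r @^-1` V) (f \o r)) ->
  morphism F.
Proof.
move=> Fr op rg.
have preE (V : set Y) : GLmod_pi B @^-1` ((fun x : A => val x) @` (F @^-1` V)) =
    GLmod_pi B @^-1` A `&` r @^-1` V.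
  apply/seteqP; split => g /=.
    move=> [x Vx xg]; rewrite -(Fr g x) //; split => //.
    by rewrite -xg; exact: set_valP.
  move=> [Ag Vg]; exists (exist _ (GLmod_pi B g) (mem_set Ag)) => //.
  by rewrite (Fr g).
split.
  apply/continuousP => V oV.
  exists ((fun x : A => val x) @` (F @^-1` V)).
    by apply/quot_open; rewrite [_ @^-1` _]preE; exact: op.
  apply/seteqP; split => x /=; last by move=> Vx; exists x.
  by move=> [y Vy /val_inj <-].
move=> V f oV fV.
have [Fl FlE] : exists Fl : GLmod B -> k, forall x : A, Fl (val x) = f (F x).
  have /choice[Fl FlE] : forall y : GLmod B, exists c : k,
      forall x : A, val x = y -> c = f (F x).
    move=> y; have [[x xy]|nx] := pselect (exists x : A, val x = y).
      exists (f (F x)) => x' x'y; congr (f (F _)).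
      by apply/val_inj; rewrite xy x'y.
    by exists 0 => x xy; case: nx; exists x.
  by exists Fl => x; exact: FlE.
exists Fl; last by move=> x _ /=; rewrite FlE.
rewrite /= -[quot_proj _]/(GLmod_pi B) preE.
apply: regular_GL_ext (rg V f oV fV) => g [Ag _] /=.
by rewrite -(Fr g (exist _ (GLmod_pi B g) (mem_set Ag))) // -FlE.
Qed.

Lemma morphism_to_open (M : nat) (X : fspace k) (S : set X)
    (xi : GL k M -> open_fspace S) (s : GL k M -> X) :
  open S -> (forall h, val (xi h : S) = s h) ->
  @morphism k (GL_fspace k M) X s ->
  @morphism k (GL_fspace k M) (open_fspace S) xi.
Proof.
move=> oS xiE [/continuousP cs rs].
split.
  apply/continuousP => _ [O oO <-].
  rewrite (_ : _ @^-1` _ = s @^-1` O); first exact: cs.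
  by apply/seteqP; split => h /=; rewrite xiE.
move=> _ f [O oO <-] [F rF fF].
set W := (fun x : S => val x) @^-1` O in rF fF *.
have WE : (fun x : S => val x) @` W = O `&` S.
  apply/seteqP; split => [_ [x Ox <-]|y [Oy Sy]].
    by split => //; exact: set_valP.
  by exists (exist _ y (mem_set Sy)).
have oW : open ((fun x : S => val x) @` W) by rewrite WE; exact: openI.
have := rs _ F oW rF.
have -> : s @^-1` ((fun x : S => val x) @` W) = xi @^-1` W.
  rewrite WE; apply/seteqP; split => h /=; rewrite /W /= -xiE; first by case.
  by move=> Oh; split => //; exact: set_valP.
apply: regular_GL_ext => h Wh /=.
by rewrite fF // xiE.
Qed.

End OpenPart.

(** * From flags in dimension n + 1 to flags in dimension n *)

Section Reduction.
Variables (k : fieldType) (n : nat).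
Implicit Types (M b : 'M[k]_(n + 1)) (h : 'M[k]_n).

(** Up to a scalar, the last row of the inverse: the linear form that vanishes
    on the first n columns of M. The adjugate makes it polynomial in M. *)
Definition covec M : 'rV[k]_(n + 1) := dsubmx (\adj M).

(** Rescaling the coordinates by [covec M] moves the span of the first n
    columns of M to the hyperplane where the coordinates sum to zero;
    forgetting the last coordinate identifies this hyperplane with k^n. The
    columns of [red M] are what becomes of the first n columns of M. *)
Definition red M : 'M[k]_n := ulsubmx (diag_mx (covec M) *m M).

(** The first n columns are those of h, lifted to the hyperplane where the
    coordinates sum to zero. *)
Definition sec h : 'M[k]_(n + 1) :=
  block_mx h 0 (- (const_mx 1 *m h)) (1%:M : 'M_1).

Lemma covec_mul M : covec M *m M = row_mx 0 (\det M)%:M.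
Proof.
rewrite /covec mul_dsub_mx mul_adj_mx scalar_mx_block.
by rewrite /block_mx col_mxKd.
Qed.

(** This characterisation replaces computations with adjugates. *)
Lemma covec_uniq M (v : 'rV_(n + 1)) :
  M \in unitmx -> v *m M = row_mx 0 (\det M)%:M -> covec M = v.
Proof.
by move=> uM vM; apply: (can_inj (mulmxK uM)); rewrite covec_mul vM.
Qed.

Lemma det_ublockE b : dlsubmx b = 0 ->
  \det b = \det (ulsubmx b) * drsubmx b 0 0.
Proof.
move=> b0; rewrite -{1}(submxK b) b0 det_ublock; congr (_ * _).
by rewrite {1}[drsubmx b]mx11_scalar det_scalar1.
Qed.

Lemma covec_mulr M b : M \in unitmx -> b \in unitmx -> dlsubmx b = 0 ->
  covec (M *m b) = \det (ulsubmx b) *: covec M.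
Proof.
move=> uM ub b0; apply: covec_uniq; first by rewrite unitmx_mul uM.
rewrite mulmxA -!scalemxAl covec_mul.
have -> : row_mx 0 (\det M)%:M *m b =
    row_mx 0 (\det M * drsubmx b 0 0)%:M :> 'rV_(n + 1).
  rewrite -{1}(submxK b) b0 mul_row_block !mul0mx mulmx0 !add0r mul_scalar_mx.
  by rewrite {1}[drsubmx b]mx11_scalar scale_scalar_mx.
rewrite scale_row_mx scaler0 scale_scalar_mx det_mulmx (det_ublockE b0).
by rewrite mulrCA.
Qed.

Lemma ulsubmx_mulr M b : dlsubmx b = 0 ->
  ulsubmx (M *m b) = ulsubmx M *m ulsubmx b.
Proof.
move=> b0; rewrite -{1}(submxK M) -{1}(submxK b) b0 mulmx_block block_mxKul.
by rewrite mulmx0 addr0.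
Qed.

Lemma ulsubmxZ c M : ulsubmx (c *: M) = c *: ulsubmx M.
Proof. by apply/matrixP => i j; rewrite !mxE. Qed.

(** Column operations that preserve the span of the first n columns change the
    linear form by a scalar only. *)
Lemma red_mulr M b : M \in unitmx -> b \in unitmx -> dlsubmx b = 0 ->
  red (M *m b) = red M *m (\det (ulsubmx b) *: ulsubmx b).
Proof.
move=> uM ub b0; rewrite /red covec_mulr // mulmxA ulsubmx_mulr //.
set c := \det (ulsubmx b).
rewrite linearZ -[X in ulsubmx X]scalemxAl ulsubmxZ.
by rewrite -[LHS]scalemxAl -[RHS]scalemxAr.
Qed.

Lemma covec_diag M (d : 'rV_(n + 1)) : M \in unitmx ->
  diag_mx d \in unitmx ->
  covec (diag_mx d *m M) *m diag_mx d = \det (diag_mx d) *: covec M.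
Proof.
move=> uM ud; apply: (can_inj (mulmxK uM)).
rewrite -mulmxA covec_mul -scalemxAl covec_mul det_mulmx scale_row_mx scaler0.
by rewrite scale_scalar_mx.
Qed.

Lemma diag_mxM (d e : 'rV[k]_(n + 1)) :
  diag_mx (d *m diag_mx e) = diag_mx d *m diag_mx e.
Proof.
by rewrite mul_mx_diag mulmx_diag; congr diag_mx; apply/rowP => i; rewrite !mxE.
Qed.

(** The diagonal matrix rescales the rows of M and the entries of [covec M] in
    inverse ways. *)
Lemma red_diag M (d : 'rV_(n + 1)) : M \in unitmx ->
  \det (diag_mx d) = 1 -> red (diag_mx d *m M) = red M.
Proof.
move=> uM d1; rewrite /red mulmxA -diag_mxM covec_diag ?d1 ?scale1r //.
by rewrite unitmxE d1 unitr1.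
Qed.

(** The form with all coefficients 1 vanishes on the first n columns after the
    rescaling. *)
Lemma ones_red M :
  (const_mx 1 : 'rV_(n + 1)) *m (diag_mx (covec M) *m M) = row_mx 0 (\det M)%:M.
Proof.
rewrite -covec_mul mulmxA; congr (_ *m _).
by apply/rowP => i; rewrite mul_mx_diag !mxE mul1r.
Qed.

Lemma const_mx11 : const_mx 1 = 1%:M :> 'M[k]_1.
Proof. by apply/matrixP => i j; rewrite !ord1 !mxE eqxx. Qed.

(** After the rescaling, the bottom entries of the first n columns are
    determined by the other ones, so these columns coincide with those of [sec
    (red M)]. *)
Lemma red_decomp M : red M \in unitmx ->
  diag_mx (covec M) *m M = sec (red M) *m
    block_mx 1%:M (invmx (red M) *m ursubmx (diag_mx (covec M) *m M))
      0 (\det M)%:M.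
Proof.
move=> uR; have := ones_red M.
set K := diag_mx (covec M) *m M.
rewrite -{1}(submxK K) -(row_mx_const 1 n 1) mul_row_block => /eq_row_mx.
rewrite const_mx11 !mul1mx => -[/eqP e1 /eqP e2].
move: e1 e2; rewrite [_ *m _ + _]addrC addr_eq0 => /eqP e1.
rewrite [_ *m _ + _]addrC eq_sym -subr_eq => /eqP/esym e2.
rewrite /red -/K in uR *.
rewrite -{1}(submxK K) e1 e2 /sec mulmx_block.
rewrite !mulmx1 !mul0mx !mulmx0 !addr0 mul1mx (mulKVmx uR).
by rewrite mulNmx -mulmxA (mulKVmx uR) addrC.
Qed.

Lemma det_sec h : \det (sec h) = \det h.
Proof. by rewrite det_lblock det1 mulr1. Qed.

Lemma covec_sec h : h \in unitmx -> covec (sec h) = const_mx (\det h).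
Proof.
move=> uh; have us : sec h \in unitmx by rewrite unitmxE det_sec -unitmxE.
apply: covec_uniq => //; rewrite -(row_mx_const 1 n 1) mul_row_block.
rewrite mulmx0 add0r mulmx1 det_sec; congr row_mx; last first.
  by apply/matrixP => i j; rewrite !ord1 !mxE eqxx.
apply/eqP; rewrite mulmxN subr_eq0 mulmxA; apply/eqP; congr (_ *m _).
by apply/rowP => i; rewrite !mxE big_ord1 !mxE mulr1.
Qed.

Lemma red_sec h : h \in unitmx -> red (sec h) = \det h *: h.
Proof.
move=> uh; rewrite /red covec_sec // diag_const_mx mul_scalar_mx.
by rewrite ulsubmxZ block_mxKul.
Qed.

(** Hence [red M] is invertible iff no coefficient of the linear form
    vanishes. *)
Lemma det_red M : M \in unitmx -> \det (red M) = \det (diag_mx (covec M)).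
Proof.
move=> uM; have detM : \det M != 0 by rewrite -unitfE -unitmxE.
apply: (mulIf detM); rewrite -det_mulmx.
set K := diag_mx (covec M) *m M.
(* adding all rows to the last one clears it except in the last column *)
pose U : 'M[k]_(n + 1) := block_mx 1%:M 0 (const_mx 1) 1%:M.
have -> : \det K = \det (U *m K).
  by rewrite (det_mulmx U K) /U (@det_lblock _ n 1) !det1 !mul1r.
have -> : U *m K = block_mx (red M) (ursubmx K) 0 (\det M)%:M.
  have e : row_mx (const_mx 1) 1%:M *m K = row_mx 0 (\det M)%:M.
    rewrite -ones_red -(row_mx_const 1 n 1); congr (row_mx _ _ *m _).
    by apply/matrixP => i j; rewrite !ord1 !mxE eqxx.
  rewrite /U {1}/block_mx mul_col_mx e.
  by rewrite -{1}(submxK K) mul_row_block !mul1mx !mul0mx !addr0.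
by rewrite det_ublock det_scalar1.
Qed.

Lemma sec_mul h (b : 'M_n) : sec (h *m b) = sec h *m block_mx b 0 0 1%:M.
Proof.
by rewrite /sec mulmx_block !mulmx0 !mul0mx !mulmx1 !addr0 add0r mulNmx mulmxA.
Qed.

End Reduction.

Section PolyRed.
Variables (k : fieldType) (n : nat).

Lemma polymap_red : polymap (@red k n).
Proof.
move=> i j.
rewrite (_ : (fun A => _) = fun A => (\adj A) (rshift n 0) (lshift 1 i) *
    A (lshift 1 i) (lshift 1 j)); last first.
  by apply/funext => A; rewrite /red mul_diag_mx !mxE.
apply: polyfun_mul; last exact: polyfun_coord.
exact: (polymap_adj (@polymap_id _ _)).
Qed.

Lemma polymap_sec : polymap (@sec k n).
Proof.
move=> i j; rewrite /sec.
case: (split_ordP i) => i' ->; case: (split_ordP j) => j' ->.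
- by rewrite (_ : (fun A => _) = fun A : 'M_n => A i' j') => [|//];
    [exact: polyfun_coord | apply/funext => A; rewrite block_mxEul].
- by rewrite (_ : (fun A => _) = fun=> 0) => [|//];
    [exact: polyfun_const | apply/funext => A; rewrite block_mxEur mxE].
- rewrite (_ : (fun A => _) = fun A : 'M_n => -1 * (const_mx 1 *m A) i' j').
    apply: polyfun_mul; first exact: polyfun_const.
    by apply: polymap_mul; [exact: polymap_const | exact: polymap_id].
  by apply/funext => A; rewrite block_mxEdl mxE mulN1r.
- rewrite (_ : (fun A => _) = fun=> (1%:M : 'M_1) i' j').
    exact: polyfun_const.
  by apply/funext => A; rewrite block_mxEdr.
Qed.

End PolyRed.

(** * Upper triangular matrices and leading minors *)

Section Triangular.
Variables (k : fieldType) (N : nat).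
Implicit Types (b c M : 'M[k]_N).

Lemma utrigP b :
  reflect (forall i j : 'I_N, (j < i)%N -> b i j = 0) (is_trig_mx b^T).
Proof.
apply: (iffP is_trig_mxP) => h i j ij; last by rewrite mxE h.
by have := h j i ij; rewrite mxE.
Qed.

Lemma utrig_det b : is_trig_mx b^T -> \det b = \prod_i b i i.
Proof.
by move=> /det_trig; rewrite det_tr => ->; apply: eq_bigr => i _; rewrite mxE.
Qed.

Lemma utrig_diag_neq0 b i : is_trig_mx b^T -> b \in unitmx -> b i i != 0.
Proof.
move=> tb; rewrite unitmxE utrig_det // unitfE => /prodf_neq0; exact.
Qed.

Lemma utrig_mul b c : is_trig_mx b^T -> is_trig_mx c^T -> is_trig_mx (b *m c)^T.
Proof.
move=> /utrigP tb /utrigP tc; apply/utrigP => i j ji.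
rewrite mxE big1 // => l _.
case: (ltnP l i) => [li|il]; first by rewrite tb // mul0r.
by rewrite tc ?mulr0 // (leq_trans ji).
Qed.

(** Column by column: below the diagonal, the entry (i, j) of b^-1 * b is the
    entry (i, j) of b^-1 times b_jj, as the earlier columns of b^-1 vanish
    there. *)
Lemma utrig_inv b : is_trig_mx b^T -> b \in unitmx -> is_trig_mx (invmx b)^T.
Proof.
move=> tb ub; apply/utrigP => i j.
have [m] := ubnP (nat_of_ord j); elim: m j => // m IH j /ltnSE jm ji.
have /matrixP/(_ i j) := mulVmx ub.
rewrite !mxE (bigD1 j) //= big1 => [|r rj].
  rewrite addr0 (_ : (i == j) = false); last first.
    by apply/eqP => e; rewrite e ltnn in ji.
  move=> /eqP; rewrite mulf_eq0 (negPf (utrig_diag_neq0 j tb ub)) orbF.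
  by move=> /eqP.
have [jr|rj'] := ltnP j r; first by rewrite (elimT (utrigP b) tb) ?mulr0.
have {}rj : (r < j)%N by rewrite ltn_neqAle rj.
by rewrite (IH r (leq_trans rj jm) (ltn_trans rj ji)) mul0r.
Qed.

Lemma utrig_scale s b : is_trig_mx b^T -> is_trig_mx (s *: b)^T.
Proof.
by move=> /utrigP tb; apply/utrigP => i j ij; rewrite mxE tb ?mulr0.
Qed.

(** Its determinant is the leading minor of order i of M; keeping the size N
    makes [leadmx_mulr] an identity of matrix products instead of an instance
    of the Cauchy-Binet formula. *)
Definition leadmx (i : nat) M : 'M[k]_N :=
  \matrix_(r, c) if (c < i)%N then M r c else (r == c)%:R.

Lemma leadmx_mulr i M b : is_trig_mx b^T ->
  leadmx i (M *m b) = leadmx i M *m leadmx i b.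
Proof.
move=> /utrigP tb; apply/matrixP => r c; rewrite !mxE.
case: ltnP => ci.
  apply: eq_bigr => l _; rewrite !mxE ci.
  case: ltnP => // il; rewrite tb ?mulr0 //; exact: leq_trans il.
rewrite (bigD1 c) //= !mxE ltnNge ci /= eqxx mulr1 big1 ?addr0 // => l lc.
by rewrite !mxE [(c < i)%N]ltnNge ci /= (negPf lc) mulr0.
Qed.

Lemma det_leadmx i b : is_trig_mx b^T ->
  \det (leadmx i b) = \prod_(c < N | (c < i)%N) b c c.
Proof.
move=> /utrigP tb; rewrite utrig_det; last first.
  apply/utrigP => r c rc; rewrite !mxE; case: ifP => _; first exact: tb.
  by case: eqP rc => // ->; rewrite ltnn.
rewrite [RHS]big_mkcond /=; apply: eq_bigr => c _.
by rewrite mxE eqxx.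
Qed.

Lemma leadmx1 i : leadmx i 1%:M = 1%:M.
Proof. by apply/matrixP => r c; rewrite !mxE if_same. Qed.

End Triangular.

Lemma utrig_dlsubmx (k : fieldType) n (b : 'M[k]_(n + 1)) :
  is_trig_mx b^T -> dlsubmx b = 0.
Proof.
move=> /utrigP tb; apply/matrixP => i j; rewrite !mxE; apply: tb.
by rewrite /= ord1 addn0.
Qed.

Lemma utrig_ulsubmx (k : fieldType) n (b : 'M[k]_(n + 1)) :
  is_trig_mx b^T -> is_trig_mx (ulsubmx b)^T.
Proof. by move=> /utrigP tb; apply/utrigP => i j ij; rewrite !mxE tb. Qed.

Section StableSection.
Variables (k : fieldType) (n : nat) (l : nat -> nat).
Hypotheses (l_noninc : forall i : 'I_n, (l i.+1 <= l i)%N) (ln : l n = 0%N).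

Definition weight_prod (b : 'M[k]_(n + 1)) : k :=
  \prod_(i < n) b (lshift 1 i) (lshift 1 i) ^+ l i /
  b (rshift n 0) (rshift n 0) ^+ (\sum_(i < n) l i).

(** The invariant section that detects semistability. Its exponents are the
    coefficients of (l_0, ..., l_(n-1)) on the fundamental weights (1, ..., 1,
    0, ..., 0) of GL_n. *)
Definition minor_section (C : 'M[k]_n) (M : 'M[k]_(n + 1)) : k :=
  \prod_(i < n) \det (leadmx i.+1 (C *m red M)) ^+ (l i - l i.+1) /
  \det M ^+ (\sum_(i < n) l i).

(** Summation by parts. *)
Lemma prod_lead_weights (x : 'I_n -> k) :
  \prod_(i < n) (\prod_(c < n | (c < i.+1)%N) x c) ^+ (l i - l i.+1) =
  \prod_(c < n) x c ^+ l c.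
Proof.
under eq_bigr do rewrite -prodrXl.
rewrite (exchange_big_dep predT) //=; apply: eq_bigr => c _.
rewrite prodrXr; congr (_ ^+ _).
have tel N : (c <= N <= n)%N ->
    (\sum_(i < N | (c < i.+1)%N) (l i - l i.+1) + l N = l c)%N.
  elim: N => [|N IH] /andP[cN Nn].
    by rewrite big_ord0 add0n; congr l; apply/esym/eqP; rewrite -leqn0.
  rewrite big_mkcond big_ord_recr -big_mkcond /= ltnS.
  have [cN'|Nc] := leqP c N.
    by rewrite -addnA subnK ?(l_noninc (Ordinal Nn)) // IH // cN' ltnW.
  have -> : N.+1 = c by apply/eqP; rewrite eqn_leq cN Nc.
  rewrite addn0 big1 // => i; rewrite ltnS leqNgt => /negP[].
  by rewrite (leq_trans (ltn_ord i)) // -ltnS (leq_trans Nc).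
have := tel n; rewrite ln addn0 => -> //.
by rewrite leqnn ltnW.
Qed.

(** Besides b itself, [red_mulr] contributes to each leading minor a power of
    s = b_00 ... b_(n-1,n-1). Altogether this is s to the power l_0 + ... +
    l_(n-1), which the power of the determinant in the denominator turns into
    a power of b_nn. *)
Lemma minor_section_mulr C M b : M \in unitmx -> b \in unitmx ->
  is_trig_mx b^T ->
  minor_section C (M *m b) = weight_prod b * minor_section C M.
Proof.
move=> uM ub tb.
have b0 := utrig_dlsubmx tb; have tul := utrig_ulsubmx tb.
rewrite /minor_section red_mulr // mulmxA.
set s := \det (ulsubmx b); set a := ulsubmx b in tul s *.
have tsa : is_trig_mx (s *: a)^T by exact: utrig_scale.
under eq_bigr do rewrite leadmx_mulr // det_mulmx (det_leadmx _ tsa) exprMn.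
rewrite big_split /= prod_lead_weights det_mulmx exprMn (det_ublockE b0).
have -> : \prod_(c < n) (s *: a) c c ^+ l c =
    s ^+ (\sum_(c < n) l c) * \prod_(c < n) a c c ^+ l c.
  rewrite -prodrXr -big_split /=; apply: eq_bigr => c _.
  by rewrite mxE exprMn.
have s0 : s != 0.
  move: ub; rewrite unitmxE (det_ublockE b0) unitfE mulf_eq0 negb_or.
  by case/andP.
have -> : weight_prod b =
    \prod_(c < n) a c c ^+ l c / drsubmx b 0 0 ^+ (\sum_(i < n) l i).
  rewrite /weight_prod !mxE; congr (_ / b _ _ ^+ _).
  by apply: eq_bigr => c _; rewrite !mxE.
rewrite -/s exprMn !invfM mulrA.
set u := s ^+ _; have u0 : u != 0 by rewrite expf_neq0.
set p := \prod_(i < n) _; set q := \prod_(i < n) _.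
set v := _^-1; set w := (drsubmx b 0 0 ^+ _)^-1.
by clearbody p q u v w; field.
Qed.

End StableSection.

(** * The weight chi *)

Section Weight.
Variables (k : fieldType) (n : nat) (chi : 'rV[int]_(n + 1)).

Definition weight (b : 'M[k]_(n + 1)) : k := \prod_j b j j ^ chi 0 j.

Lemma weight_neq0 b : is_trig_mx b^T -> b \in unitmx -> weight b != 0.
Proof.
move=> tb ub; apply/prodf_neq0 => j _; apply: expfz_neq0.
exact: utrig_diag_neq0.
Qed.

(** Combinations of roots have degree zero, hence are trivial on scalar
    matrices. *)
Lemma weight_scalar c : c != 0 -> \sum_j chi 0 j = 0 -> weight c%:M = 1.
Proof.
move=> c0 chi0; rewrite /weight -[RHS](expr0z c) -chi0.
rewrite (big_morph (exprz c) (fun _ _ => expfzDr _ _ c0) (expr0z c)).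
by apply: eq_bigr => j _; rewrite mxE eqxx.
Qed.

End Weight.

Section WeightShape.
Variables (n : nat).

Lemma sum_delta N (F : nat -> int) a : (a < N)%N ->
  \sum_(j < N) F j * (j == a :> nat)%:R = F a.
Proof.
move=> aN; rewrite (bigD1 (Ordinal aN)) //= eqxx mulr1 big1 ?addr0 // => j ja.
rewrite (_ : (j == a :> nat) = false) ?mulr0 //; apply/eqP => e.
by case/eqP: ja; apply/val_inj.
Qed.

(** The coordinates of chi are m_0, m_1 - m_0, ..., m_(n-1) - m_(n-2),
    -m_(n-1), and dominance says that they decrease; it therefore suffices
    that the last but one is positive. For n > 1 this holds because m
    increases, for n = 1 because m_0 > - m_0. *)
Lemma weight_shape (m : 'I_n -> nat) (chi : 'rV[int]_(n + 1)) :
  (0 < n)%N -> chi = \sum_(i < n) simple_root i *+ m i ->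
  regular_dominant chi ->
  (forall i j : 'I_n, nat_of_ord j = i.+1 -> (m i < m j)%N) ->
  exists l : nat -> nat,
    [/\ forall i : 'I_n, chi 0 (lshift 1 i) = (l i)%:Z,
        forall i : 'I_n, (0 < l i)%N,
        forall i : 'I_n, (l i.+1 <= l i)%N,
        l n = 0%N &
        chi 0 (rshift n 0) = - (\sum_(i < n) l i)%:Z].
Proof.
move=> n_gt0 chiE chi_reg m_incr.
pose mm i := if insub i is Some i' then m i' else 0%N.
have mmE (i : 'I_n) : mm i = m i by rewrite /mm valK.
have mm0 i : (n <= i)%N -> mm i = 0%N.
  by move=> ni; rewrite /mm insubF // ltnNge ni.
pose c j : int := (mm j)%:Z - (if j is j'.+1 then mm j' else 0%N)%:Z.
have chic j : chi 0 j = c j.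
  rewrite chiE summxE /c.
  under eq_bigr do rewrite mulmxnE mxE mulrnBl.
  rewrite sumrB; congr (_ - _).
    have [jn|nj] := ltnP j n; last first.
      rewrite mm0 // big1 // => i _.
      by rewrite gtn_eqF ?mul0rn // (leq_trans (ltn_ord i)).
    rewrite (bigD1 (Ordinal jn)) //= eqxx big1 ?addr0.
      by rewrite (mmE (Ordinal jn)) natz.
    move=> i ij; case: eqP => [e|_]; last by rewrite mul0rn.
    by case/eqP: ij; apply: val_inj.
  case: j => -[|j] /= jn1; first by rewrite big1 // => i _; rewrite mul0rn.
  have jn : (j < n)%N by rewrite addn1 in jn1.
  rewrite (bigD1 (Ordinal jn)) //= eqxx big1 ?addr0.
    by rewrite (mmE (Ordinal jn)) natz.
  move=> i ij; rewrite eqSS; case: eqP => [e|_]; last by rewrite mul0rn.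
  by case/eqP: ij; apply: val_inj.
have c_decr i : (i < n)%N -> c i.+1 < c i.
  move=> i_n; have := chi_reg (Ordinal i_n); rewrite /coroot_pairing.
  under eq_bigr do rewrite chic mxE mulrBr.
  by rewrite sumrB !sum_delta /=; lia.
have c_last : 0 < c n.-1.
  have [n1|n1] := eqVneq n 1%N.
    have := c_decr 0%N; rewrite n1 /c /=; lia.
  have h : (n.-2 < n)%N /\ (n.-1 < n)%N by lia.
  have := m_incr (Ordinal h.1) (Ordinal h.2).
  rewrite -!mmE /=; case: n n_gt0 n1 h => [|[|N]] //= _ _ _ /(_ erefl).
  rewrite /c; lia.
have c_pos i : (i < n)%N -> 0 < c i.
  move=> i_n; have [N] := ubnP (n - i)%N; elim: N i i_n => // N IH i i_n iN.
  have [e|ne] := eqVneq i n.-1; first by rewrite e.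
  have i1 : (i.+1 < n)%N by lia.
  have := IH _ i1 ltac:(lia); have := c_decr i i_n; lia.
pose l j := if (j < n)%N then absz (c j) else 0%N.
have lc i : (i < n)%N -> (l i)%:Z = c i.
  by move=> i_n; have := c_pos i i_n; rewrite /l i_n; lia.
exists l; split => [i|i|i||].
- by rewrite chic /= lc.
- by have := c_pos i (ltn_ord i); have := lc i (ltn_ord i); lia.
- have [i1|i1] := ltnP i.+1 n; last by rewrite /l ltnNge i1.
  have := c_decr i (ltn_ord i).
  by have := lc i (ltn_ord i); have := lc _ i1; lia.
- by rewrite /l ltnn.
have tel N : (N < n)%N -> (\sum_(i < N.+1) l i)%:Z = (mm N)%:Z.
  elim: N => [|N IH] Nn.
    by rewrite big_ord_recl big_ord0 addn0 lc // /c subr0.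
  by rewrite big_ord_recr /= PoszD IH ?(ltnW Nn) // lc // /c addrC subrK.
rewrite chic /= addn0; case: n n_gt0 tel mm0 => // N _ tel mm0.
rewrite tel // /c mm0 //; lia.
Qed.

End WeightShape.

(** * Vanishing of invariant sections *)

Section Unstable.
Variables (k : closedFieldType) (n : nat).

Lemma root_addn1_exists (a : k) : exists c : k, c ^+ (n + 1) = a.
Proof.
have n1_gt0 : (0 < n + 1)%N by rewrite addn1.
have [c cE] := solve_monicpoly (fun i => if i == 0%N then a else 0) n1_gt0.
exists c; rewrite cE addn1 big_ord_recl /= mulr1 big1 ?addr0 // => i _.
by rewrite mul0r.
Qed.

Lemma diag_normalize (e : 'rV[k]_(n + 1)) : diag_mx e \in unitmx ->
  exists2 c : k, c != 0 & \det (c *: diag_mx e) = 1.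
Proof.
rewrite unitmxE unitfE => e0.
have [c cE] := root_addn1_exists (\det (diag_mx e))^-1.
exists c; last by rewrite detZ cE mulVf.
by apply: contraNneq (invr_neq0 e0) => c0; rewrite -cE c0 addn1 expr0n.
Qed.

Variables (chi : 'rV[int]_(n + 1)) (d : nat) (f : GL k (n + 1) -> k).
Hypotheses (d_gt0 : (0 < d)%N) (rf : regular_GL setT f).
Hypothesis fB : forall g b : GL k (n + 1), is_trig_mx (glmx b)^T ->
  f (mulGL g b) = weight chi b ^+ d * f g.
Hypothesis fT : forall t g : GL k (n + 1), \det t = 1 -> is_diag_mx t ->
  f (mulGL t g) = f g.
Hypothesis chi0 : \sum_j chi 0 j = 0.
Hypothesis chi_pos : forall i : 'I_n, 0 < chi 0 (lshift 1 i).

(** A diagonal matrix of any determinant is an element of the torus times a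
    scalar matrix, and scalar matrices have weight 1. *)
Lemma invariant_diag (e : 'rV[k]_(n + 1)) g : diag_mx e \in unitmx ->
  f (mulGL (toGL (diag_mx e)) g) = f g.
Proof.
move=> ue; have [c c0 cE] := diag_normalize ue.
have ut : c *: diag_mx e \in unitmx by rewrite unitmxE cE unitr1.
have uc : (c^-1)%:M \in @unitmx k (n + 1).
  by rewrite unitmxE det_scalar unitrX // unitfE invr_eq0.
have -> : mulGL (toGL (diag_mx e)) g =
    mulGL (mulGL (toGL (c *: diag_mx e)) g) (toGL (c^-1)%:M).
  apply: GL_inj; rewrite /= !toGLK // mul_mx_scalar -!scalemxAl.
  by rewrite scalerA mulVf // scale1r.
rewrite fB ?toGLK ?tr_scalar_mx ?scalar_mx_is_trig //.
rewrite weight_scalar ?invr_eq0 // expr1n mul1r fT ?toGLK //.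
by rewrite -linearZ diag_mx_is_diag.
Qed.

(** If column p is e_j, scaling e_j by s and column p by s^-1 moves g along a
    curve h which is polynomial in s and has an invertible value at s = 0. On
    the curve f equals s^(- d chi_p) * f g; as chi_p > 0, regularity of f at h
    0 forces f g = 0. *)
Lemma vanish_normalized (g : GL k (n + 1)) (j : 'I_(n + 1)) (p : 'I_n) :
  (forall r, g r (lshift 1 p) = (r == j)%:R) -> f g = 0.
Proof.
set q := lshift 1 p => gp; apply: contrapT => /eqP fg0.
pose H : 'M[{poly k}]_(n + 1) := \matrix_(r, c)
  if (r == j) && (c != q) then g r c *: 'X else (g r c)%:P.
pose h s : 'M[k]_(n + 1) := \matrix_(r, c) (H r c).[s].
have hE s r c : h s r c = if (r == j) && (c != q) then g r c * s else g r c.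
  by rewrite !mxE; case: ifP => _; rewrite ?hornerZ ?hornerX ?hornerC.
(* h 0 is g with row j cleared outside column p, a column operation on g *)
have uh0 : h 0 \in unitmx.
  have : h 0 *m (1%:M +
      \matrix_(r, c) (if (r == q) && (c != q) then g j c else 0)) = g.
    apply/matrixP => r c; rewrite mulmxDr mulmx1 mxE [X in _ + X]mxE.
    rewrite (bigD1 q) //= big1 ?addr0 => [|i iq]; last first.
      by rewrite !mxE (negPf iq) mulr0.
    rewrite !hE !mxE !eqxx /= andbF gp.
    have [->|cq] /= := eqVneq c q; first by rewrite andbF mulr0 addr0.
    rewrite andbT; case: eqVneq => [->|_]; first by rewrite mulr0 add0r mul1r.
    by rewrite mul0r addr0.
  by move=> e; have := glmxP g; rewrite -e unitmx_mul => /andP[].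
have [P0 [Q0 [pP pQ Q0n fE]]] := rf (g := toGL (h 0)) I.
have [P PE] := polyfun_curve H pP; have [Q QE] := polyfun_curve H pQ.
have [m mE] : exists m : nat, chi 0 q = m.+1%:Z.
  have := chi_pos p; rewrite -/q; case: (chi 0 q) => // -[|m] // _.
  by exists m.
(* f = P / Q near h 0; A vanishes at each s <> 0 with Q s <> 0, but not at 0 *)
pose A := f g *: Q - P * 'X^(m.+1 * d).
have Q_0 : Q.[0] != 0 by rewrite QE -/(h 0) -(toGLK uh0).
have A0 : A.[0] != 0.
  rewrite !hornerE expr0n muln_eq0 /= -[d == 0%N]negbK -lt0n d_gt0 /=.
  by rewrite mulr0 subr0 mulf_neq0.
have : A * Q * 'X != 0.
  rewrite !mulf_neq0 ?polyX_eq0 //.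
  - by apply: contraNneq A0 => ->; rewrite horner0.
  - by apply: contraNneq Q_0 => ->; rewrite horner0.
move=> /closed_nonrootP[s]; rewrite /root !hornerM hornerX !mulf_eq0 !negb_or.
move=> /andP[/andP[As Qs] s0]; case/negP: As.
pose e := \row_c (if c == j then s else 1).
pose e' := \row_c (if c == q then s^-1 else 1).
have ue : diag_mx e \in unitmx.
  rewrite unitmxE det_diag unitfE; apply/prodf_neq0 => i _; rewrite mxE.
  by case: ifP => _; rewrite ?oner_neq0.
have ue' : diag_mx e' \in unitmx.
  rewrite unitmxE det_diag unitfE; apply/prodf_neq0 => i _; rewrite mxE.
  by case: ifP => _; rewrite ?invr_eq0 ?oner_neq0.
have hs : h s = diag_mx e *m g *m diag_mx e'.
  apply/matrixP => r c; rewrite hE mul_mx_diag mul_diag_mx !mxE.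
  have [->|cq] := eqVneq c q.
    rewrite andbF gp; case: eqVneq => [_|_]; first by rewrite mulr1 mulfV.
    by rewrite mulr0 mul0r.
  rewrite andbT mulr1; case: eqVneq => [_|_]; first by rewrite mulrC.
  by rewrite mul1r.
have uhs : h s \in unitmx by rewrite hs !unitmx_mul ue ue' glmxP.
have tri : is_trig_mx (glmx (toGL (diag_mx e')))^T.
  by rewrite toGLK // tr_diag_mx; apply/diag_mx_is_trig.
have fh : f (toGL (h s)) = s ^- (m.+1 * d) * f g.
  have -> : toGL (h s) = mulGL (mulGL (toGL (diag_mx e)) g) (toGL (diag_mx e')).
    by apply: GL_inj; rewrite /= !toGLK.
  rewrite fB // invariant_diag //; congr (_ * _).
  rewrite toGLK // /weight (bigD1 q) //= big1 => [|i iq].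
    rewrite !mxE !eqxx mulr1 mE -exprnP -exprM exprVn //.
  by rewrite !mxE (negPf iq) eqxx mulr1n exp1rz.
have := fE (toGL (h s)) I; rewrite toGLK // -QE => /(_ Qs).
rewrite fh -PE => e1.
have sn0 : s ^+ (m.+1 * d) != 0 by rewrite expf_neq0.
rewrite !hornerE subr_eq0; apply/eqP.
have -> : f g = s ^+ (m.+1 * d) * (P.[s] / Q.[s]) by rewrite -e1 mulVKf.
by rewrite mulrA divfK // mulrC.
Qed.

(** A zero coefficient of the linear form means that some e_j lies in the span
    of the first n columns. If column p is the last one occurring in the
    corresponding linear combination, then an upper triangular change of
    columns replaces column p by e_j, and f only changes by a nonzero factor. *)
Lemma unstable_vanish (g : GL k (n + 1)) : red g \notin unitmx -> f g = 0.
Proof.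
rewrite unitmxE unitfE negbK det_red ?glmxP // det_diag prodf_seq_eq0.
case/hasP => j _ /= /eqP cj.
pose w := col j (invmx g).
have gw : g *m w = delta_mx j 0.
  by rewrite /w colE mulmxA mulmxV ?glmxP // mul1mx.
have wl : w (rshift n 0) 0 = 0.
  move: cj; rewrite /covec !mxE => cj.
  by rewrite /invmx glmxP !mxE cj mulr0.
(* w holds the coefficients of e_j on the columns of g *)
have [i0 wi0] : exists i, w i 0 != 0.
  apply/existsP; rewrite -negb_forall; apply/negP => /forallP w0.
  have w00 : w = 0 by apply/colP => i; rewrite [RHS]mxE; apply/eqP/w0.
  move: gw; rewrite w00 mulmx0 => /matrixP/(_ j 0) /eqP.
  by rewrite !mxE !eqxx eq_sym oner_eq0.
case: (@arg_maxnP _ i0 (fun i => w i 0 != 0) (fun i => i : nat) wi0).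
move=> p wp pmax.
have [p' pE] : exists p' : 'I_n, p = lshift 1 p'.
  case: (split_ordP p) => [p' ->|p' pE]; first by exists p'.
  by rewrite pE ord1 wl eqxx in wp.
pose u : 'M[k]_(n + 1) := \matrix_(r, c) if c == p then w r 0 else (r == c)%:R.
have tu : is_trig_mx u^T.
  apply/utrigP => r c rc; rewrite mxE; case: eqVneq => [cp|_].
    apply/eqP; apply: contraLR rc => /pmax; rewrite cp -leqNgt; exact.
  by case: eqP rc => // ->; rewrite ltnn.
have uu : u \in unitmx.
  rewrite unitmxE unitfE utrig_det //; apply/prodf_neq0 => i _; rewrite mxE.
  by case: (eqVneq i p) => [->|_] //; rewrite eqxx oner_neq0.
have colp r : mulGL g (toGL u) r (lshift 1 p') = (r == j)%:R.
  rewrite /= toGLK //; have /matrixP/(_ r 0) := gw; rewrite !mxE andbT => <-.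
  by apply: eq_bigr => i _; rewrite !mxE pE eqxx.
have /eqP := vanish_normalized colp.
rewrite fB toGLK // mulf_eq0 expf_eq0 d_gt0 /=.
by rewrite (negPf (weight_neq0 _ tu uu)) => /eqP.
Qed.

End Unstable.

(** * The semistable locus *)

Section InBasis.
Variables (k : fieldType) (n : nat) (P : GL k (n + 1)).
Implicit Types (g b t : GL k (n + 1)).

Definition out_basis g : GL k (n + 1) := mulGL (mulGL P g) (invGL P).

Lemma in_basisK : cancel (in_basis P) out_basis.
Proof.
move=> g; rewrite /in_basis /out_basis -!mulGLA mulGLV mulGL1 !mulGLA mulGLV.
by rewrite mul1GL.
Qed.

Lemma out_basisK : cancel out_basis (in_basis P).
Proof.
move=> g; rewrite /in_basis /out_basis -!mulGLA mulVGL mulGL1 !mulGLA mulVGL.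
by rewrite mul1GL.
Qed.

Lemma out_basisM g b :
  out_basis (mulGL g b) = mulGL (out_basis g) (out_basis b).
Proof.
rewrite /out_basis -!mulGLA; congr (mulGL P (mulGL g _)).
by rewrite !mulGLA mulVGL mul1GL.
Qed.

Lemma in_basisM g b :
  in_basis P (mulGL g b) = mulGL (in_basis P g) (in_basis P b).
Proof. by apply: (can_inj out_basisK); rewrite out_basisM !in_basisK. Qed.

Lemma in_basis1 : in_basis P (oneGL k (n + 1)) = oneGL k (n + 1).
Proof. by rewrite /in_basis mulGL1 mulVGL. Qed.

Lemma in_basisV g : in_basis P (invGL g) = invGL (in_basis P g).
Proof.
rewrite -[LHS]mulGL1 -(mulGLV (in_basis P g)) mulGLA -in_basisM mulVGL.
by rewrite in_basis1 mul1GL.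
Qed.

Lemma det_in_basis g : \det (in_basis P g) = \det g.
Proof.
rewrite /= !det_mulmx det_inv mulrAC mulVr ?mul1r //.
by rewrite -unitmxE glmxP.
Qed.

Lemma borelE b : borel P b = is_trig_mx (glmx (in_basis P b))^T :> Prop.
Proof. by []. Qed.

Lemma subgroup_borel : subgroup (borel P).
Proof.
split=> [|b c|b]; rewrite !borelE.
- by rewrite in_basis1 /= tr_scalar_mx scalar_mx_is_trig.
- by rewrite in_basisM; exact: utrig_mul.
- by rewrite in_basisV => tb; apply: utrig_inv tb (glmxP (in_basis P b)).
Qed.

Lemma in_basis_embed (h : GL k n) :
  glmx (in_basis P (embed P h)) = block_mx h 0 0 1%:M.
Proof. by rewrite [in_basis _ _]out_basisK. Qed.

Lemma borel_nE (h : GL k n) : borel_n P h = is_trig_mx (glmx h)^T :> Prop.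
Proof.
rewrite -[LHS]/(borel P (embed P h)) borelE in_basis_embed tr_block_mx.
by rewrite is_trig_block_mx // !trmx0 eqxx tr_scalar_mx scalar_mx_is_trig andbT.
Qed.

Lemma subgroup_borel_n : subgroup (borel_n P).
Proof.
split=> [|b c|b]; rewrite !borel_nE /=.
- by rewrite tr_scalar_mx scalar_mx_is_trig.
- exact: utrig_mul.
- by move=> tb; apply: utrig_inv => //; exact: glmxP.
Qed.

(** Triangularity of h^-1 * g is a system of polynomial equations in g. *)
Lemma GLmod_borel_n_point_closed (h : GL k n) :
  closed [set GLmod_pi (borel_n P) h].
Proof.
apply: quot_point_closed; rewrite -openC; apply/open_GL => g /= ng.
have [i [j [ij nz]]] : exists i j : 'I_n, (j < i)%N /\ (invmx h *m g) i j != 0.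
  apply: contrapT => nex; apply: ng; apply/(coset_equivP _ _ subgroup_borel_n).
  exists (mulGL (invGL h) g); last by rewrite mulGLA mulGLV mul1GL.
  rewrite borel_nE; apply/utrigP => i j ij; apply/eqP.
  by apply: contrapT => /negP nz; apply: nex; exists i, j.
exists (fun M => (invmx h *m M) i j); split => //.
  by apply: polymap_mul; [exact: polymap_const | exact: polymap_id].
move=> g' nz' /(coset_equivP _ _ subgroup_borel_n)[b].
rewrite borel_nE => tb g'E; case/eqP: nz'.
rewrite g'E /= mulmxA mulVmx ?glmxP // mul1mx.
exact: (elimT (utrigP _) tb).
Qed.

End InBasis.

Section Semistable.
Variables (k : closedFieldType) (n : nat) (P : GL k (n + 1)).
Variables (chi : 'rV[int]_(n + 1)) (l : nat -> nat).
Hypothesis chil : forall i : 'I_n, chi 0 (lshift 1 i) = (l i)%:Z.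
Hypothesis l_gt0 : forall i : 'I_n, (0 < l i)%N.
Hypothesis l_noninc : forall i : 'I_n, (l i.+1 <= l i)%N.
Hypothesis ln : l n = 0%N.
Hypothesis chi_last : chi 0 (rshift n 0) = - (\sum_(i < n) l i)%:Z.

Local Notation B := (borel P).
Local Notation Bn := (borel_n P).
Local Notation T := (torus P).
Local Notation ss := (@semistable k (n + 1) T B (character P chi)).
Local Notation pi := (GLmod_pi B).
Local Notation pin := (GLmod_pi Bn).
Implicit Types (g b t : GL k (n + 1)) (h : GL k n).

(** By [det_red]: the hyperplane of the flag contains no vector of the basis. *)
Definition generic g : Prop := red (in_basis P g) \in unitmx.

Definition redGL g : GL k n := toGL (red (in_basis P g)).

Definition redmap (A : 'M[k]_(n + 1)) : 'M[k]_n := red (invmx P *m A *m P).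

Definition secmap (A : 'M[k]_n) : 'M[k]_(n + 1) := P *m sec A *m invmx P.

Lemma sec_unit h : sec h \in unitmx.
Proof. by rewrite unitmxE det_sec -unitmxE glmxP. Qed.

Definition secGL h : GL k (n + 1) := out_basis P (GLmx (sec_unit h)).

Lemma polymap_redmap : polymap redmap.
Proof.
apply: (polymap_comp (F := fun A => invmx P *m A *m P)).
  exact: polymap_mul2.
exact: polymap_red.
Qed.

Lemma polymap_secmap : polymap secmap.
Proof.
apply: polymap_mul; last exact: polymap_const.
by apply: polymap_mul; [exact: polymap_const | exact: polymap_sec].
Qed.

Lemma redGLE g : generic g -> glmx (redGL g) = redmap g.
Proof. exact: toGLK. Qed.

Lemma generic_open : zariski_open generic.
Proof.
move=> g gg; exists (fun A => \det (redmap A)); split.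
- exact: (polyfun_det polymap_redmap).
- by move: gg; rewrite /generic unitmxE unitfE.
- by move=> g'; rewrite /generic unitmxE unitfE.
Qed.

Lemma red_borel g b : B b ->
  exists2 c : GL k n, Bn c &
    red (in_basis P (mulGL g b)) = red (in_basis P g) *m c.
Proof.
move=> Bb; have b0 := utrig_dlsubmx Bb.
set b' := in_basis P b; set s := \det (ulsubmx b').
have s0 : s != 0.
  have := GL_det_neq0 b'; rewrite (det_ublockE b0) mulf_eq0 negb_or.
  by case/andP.
have uc : s *: ulsubmx b' \in unitmx.
  by rewrite unitmxE detZ unitfE mulf_neq0 // expf_neq0.
exists (GLmx uc); first by rewrite borel_nE; apply/utrig_scale/utrig_ulsubmx.
by rewrite in_basisM glmx_mul red_mulr ?glmxP.
Qed.

Lemma generic_borel g b : B b -> generic (mulGL g b) <-> generic g.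
Proof.
move=> /(red_borel g)[c _ e]; rewrite /generic e unitmx_mul (glmxP c) andbT.
by split.
Qed.

Lemma redGL_borel g b : B b -> generic g ->
  pin (redGL (mulGL g b)) = pin (redGL g).
Proof.
move=> Bb gg; have [c Bc e] := red_borel g Bb.
apply/esym/(GLmod_piP _ _ (subgroup_borel_n P)); exists c => //.
by apply: GL_inj; rewrite redGLE ?generic_borel //= redGLE // -e.
Qed.

Lemma generic_coset g g' : pi g = pi g' -> generic g <-> generic g'.
Proof.
move=> /(GLmod_piP _ _ (subgroup_borel P))[b Bb ->].
exact: iff_sym (generic_borel g Bb).
Qed.

Lemma redGL_coset g g' : generic g -> pi g = pi g' ->
  pin (redGL g) = pin (redGL g').
Proof.
move=> gg /(GLmod_piP _ _ (subgroup_borel P))[b Bb ->].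
by rewrite redGL_borel.
Qed.

Lemma torus_diag t : T t ->
  exists2 d : 'rV_(n + 1),
    glmx (in_basis P t) = diag_mx d & \det (diag_mx d) = 1.
Proof.
move=> [t1 /diag_mxP [d dE]]; exists d; first exact: dE.
by rewrite -dE det_in_basis.
Qed.

Lemma red_torus t g : T t -> red (in_basis P (mulGL t g)) = red (in_basis P g).
Proof.
move=> /torus_diag[d dE d1]; rewrite in_basisM glmx_mul dE.
by rewrite red_diag // (glmxP (in_basis P g)).
Qed.

Lemma character_weight b : character P chi b = weight chi (in_basis P b).
Proof. by []. Qed.

Lemma weightE (b : 'M[k]_(n + 1)) : weight chi b = weight_prod l b.
Proof.
rewrite /weight big_split_ord /= big_ord1 chi_last -exprnN; congr (_ / _).
by apply: eq_bigr => i _; rewrite chil.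
Qed.

(** The positivity of chi_0, ..., chi_(n-1) makes [unstable_vanish]
    applicable; together with dominance it also makes the exponents of
    [minor_section] non-negative. *)
Lemma semistableP g : ss (pi g) <-> generic g.
Proof.
split=> [[d [f [d0 [rf fB] fT [g' g'g fg']]]]|gg].
  apply/(generic_coset (esym g'g)); apply: contrapT => /negP ng.
  case/eqP: fg'.
  have := @unstable_vanish k n chi d (f \o out_basis P) d0 _ _ _ _ _
    (in_basis P g') ng.
  rewrite /= in_basisK; apply.
  - have := polymap_regular (U := setT) (F := out_basis P)
      (polymap_mul2 P (invmx P)) (fun _ _ => erefl) rf.
    by rewrite preimage_setT setTI.
  - move=> x b tb /=; rewrite out_basisM fB ?borelE ?out_basisK //.
    by rewrite character_weight out_basisK.
  - move=> t x t1 td /=; rewrite out_basisM fT //; split.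
      by rewrite -(det_in_basis P) out_basisK.
    by rewrite out_basisK.
  - rewrite big_split_ord /= big_ord1 chi_last.
    under eq_bigr do rewrite chil.
    by rewrite -(big_morph Posz PoszD erefl) subrr.
  - by move=> i; rewrite chil ltz_nat.
(* with this C all the leading minors in the section are 1 at g *)
pose C := invmx (red (in_basis P g)).
pose f (x : GL k (n + 1)) : k := minor_section l C (in_basis P x).
exists 1%N, f; split => //; first split.
- move=> x _.
  exists (fun A => \prod_(i < n)
             \det (leadmx i.+1 (C *m redmap A)) ^+ (l i - l i.+1)),
    (fun A => \det A ^+ (\sum_(i < n) l i)); split.
  + apply: polyfun_prod => i; apply: polyfun_exp; apply: polyfun_det => r c.
    rewrite (_ : (fun A => _) = fun A =>
        if (c < i.+1)%N then (C *m redmap A) r c else (r == c)%:R); last first.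
      by apply/funext => A; rewrite mxE.
    case: (c < i.+1)%N; last exact: polyfun_const.
    by apply: polymap_mul; [exact: polymap_const | exact: polymap_redmap].
  + by apply: polyfun_exp; exact: (polyfun_det (@polymap_id _ _)).
  + by rewrite expf_neq0 // GL_det_neq0.
  + by move=> x' _ _; rewrite /f /minor_section det_in_basis.
- move=> x b Bb; rewrite /f in_basisM minor_section_mulr ?glmxP //.
  by rewrite expr1 character_weight weightE.
- move=> t x Tt; rewrite /f /minor_section red_torus // !det_in_basis.
  by rewrite glmx_mul det_mulmx Tt.1 mul1r.
exists g => //; rewrite /f /minor_section mulVmx //.
rewrite mulf_neq0 ?invr_eq0 ?expf_neq0 ?det_in_basis ?GL_det_neq0 //.
by apply/prodf_neq0 => i _; rewrite leadmx1 det1 expr1n oner_neq0.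
Qed.

Lemma generic_secGL h : generic (secGL h).
Proof.
rewrite /generic out_basisK /= red_sec ?glmxP // unitmxE detZ unitfE.
by rewrite mulf_neq0 ?expf_neq0 // GL_det_neq0.
Qed.

(** For a matrix whose hyperplane is already the one where the coordinates sum
    to zero, the rescaling is by a scalar, which lies in the Borel subgroup. *)
Lemma redGL_secGL h : pin (redGL (secGL h)) = pin h.
Proof.
apply/esym/(GLmod_piP _ _ (subgroup_borel_n P)).
have us : (\det h)%:M \in @unitmx k n.
  by rewrite unitmxE det_scalar unitfE expf_neq0 // GL_det_neq0.
exists (GLmx us); first by rewrite borel_nE /= tr_scalar_mx scalar_mx_is_trig.
apply: GL_inj; rewrite toGLK; last exact: generic_secGL.
by rewrite out_basisK /= red_sec ?glmxP // mul_mx_scalar.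
Qed.

Lemma secGL_borel h c : Bn c -> pi (secGL (mulGL h c)) = pi (secGL h).
Proof.
move=> Bc; apply/esym/(GLmod_piP _ _ (subgroup_borel P)).
exists (embed P c) => //; apply: (can_inj (in_basisK P)).
apply: GL_inj; rewrite in_basisM glmx_mul in_basis_embed /secGL !out_basisK.
exact: sec_mul.
Qed.

(** The diagonal matrix of [red_decomp] is made an element of the torus by
    extracting a root of its determinant; the scalar is absorbed by the Borel
    subgroup. *)
Lemma secGL_redGL g : generic g ->
  exists2 t, T t & pi (secGL (redGL g)) = pi (mulGL t g).
Proof.
move=> gg; set M : 'M[k]_(n + 1) := in_basis P g.
have uM : M \in unitmx by exact: (glmxP (in_basis P g)).
have ud : diag_mx (covec M) \in unitmx by rewrite unitmxE -det_red // -unitmxE.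
have [c c0 c1] := diag_normalize ud.
have ut : c *: diag_mx (covec M) \in unitmx by rewrite unitmxE c1 unitr1.
exists (out_basis P (GLmx ut)).
  split; first by rewrite -(det_in_basis P) out_basisK.
  by rewrite out_basisK /= -linearZ diag_mx_is_diag.
have := red_decomp gg; rewrite -/M.
set b := block_mx _ _ _ _ => bE.
have ub : c *: b \in unitmx.
  have : diag_mx (covec M) *m M \in unitmx by rewrite unitmx_mul ud.
  rewrite bE unitmx_mul => /andP[_]; rewrite !unitmxE detZ !unitfE => b0.
  by rewrite mulf_neq0 // expf_neq0.
apply/(GLmod_piP _ _ (subgroup_borel P)); exists (out_basis P (GLmx ub)).
  rewrite borelE out_basisK /=; apply: utrig_scale.
  rewrite /b tr_block_mx is_trig_block_mx // trmx0 eqxx !tr_scalar_mx.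
  by rewrite !scalar_mx_is_trig.
apply: (can_inj (in_basisK P)).
rewrite in_basisM [RHS]in_basisM /secGL !out_basisK; apply: GL_inj.
have e : c *: diag_mx (covec M) *m M = sec (redGL g) *m (c *: b).
  by rewrite toGLK // -scalemxAr -bE -scalemxAl.
exact: e.
Qed.

End Semistable.

(** * The isomorphism *)

Section Iso.
Variables (k : closedFieldType) (n : nat) (P : GL k (n + 1)).
Variables (chi : 'rV[int]_(n + 1)).
Local Notation B := (borel P).
Local Notation Bn := (borel_n P).
Local Notation T := (torus P).
Local Notation ss := (@semistable k (n + 1) T B (character P chi)).
Local Notation X := (@ss_fspace k (n + 1) T B (character P chi)).
Local Notation Q := (@git_quotient k (n + 1) T B (character P chi)).
Local Notation pi := (GLmod_pi B).
Local Notation pin := (GLmod_pi Bn).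
Hypothesis ssP : forall g, ss (pi g) <-> generic P g.

Local Notation orbit_rel := (fun x y : X =>
  closure (ss_orbit x) `&` closure (ss_orbit y) !=set0).
Local Notation q := (@quot_proj k X orbit_rel : X -> Q).

Lemma X_repr (x : X) : exists2 g, pi g = val (x : ss) & generic P g.
Proof.
have [g gx] := GLmod_pi_surj (val (x : ss)); exists g => //.
by apply/ssP; rewrite gx; exact: set_valP.
Qed.

Lemma red_map_exists : exists2 Phi : X -> GLmod Bn,
  forall g (x : X), pi g = val (x : ss) -> Phi x = pin (redGL P g) &
  morphism Phi.
Proof.
have /choice[Phi PhiE] : forall x : X, exists z : GLmod Bn,
    forall g, pi g = val (x : ss) -> z = pin (redGL P g).
  move=> x; have [g gx gg] := X_repr x; exists (pin (redGL P g)) => g' g'x.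
  by apply: redGL_coset => //; rewrite gx g'x.
exists Phi => [g x gx|]; first exact: PhiE.
have preE : pi @^-1` ss = generic P.
  by apply/seteqP; split => g /=; rewrite ssP.
apply: (@morphism_from_open _ _ _ _ _ _ (pin \o redGL P)).
- by move=> g x gx; exact: PhiE.
- move=> V oV; rewrite preE.
  exact: (@polymap_open k _ _ _ _ _ (pin @^-1` V) (@polymap_redmap k n P)
    (@generic_open k n P) (@redGLE k n P) oV).
- move=> V f oV fV; rewrite preE.
  exact: (@polymap_regular k _ _ _ _ _ (pin @^-1` V) (f \o pin)
    (@polymap_redmap k n P) (@redGLE k n P) fV).
Qed.

(** The fibres of Phi are closed unions of T-orbits, so an orbit closure stays
    inside one fibre. *)
Lemma orbit_closure_eq (Phi : X -> GLmod Bn) :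
  (forall g (x : X), pi g = val (x : ss) -> Phi x = pin (redGL P g)) ->
  continuous Phi -> forall x y, orbit_rel x y -> Phi x = Phi y.
Proof.
move=> PhiE cPhi.
have sub x : closure (ss_orbit x) `<=` Phi @^-1` [set Phi x].
  have cl : closed (Phi @^-1` [set Phi x]).
    have [g <-] : exists g, pin g = Phi x by exact: GLmod_pi_surj.
    apply: preimage_closed; last exact: GLmod_borel_n_point_closed.
    by move=> z _; exact: cPhi.
  rewrite [X in _ `<=` X](closure_id _).1 //; apply: closureS.
  move=> y [t [g [Tt gx gy]]] /=.
  by rewrite (PhiE _ _ gx) (PhiE _ _ gy) /redGL red_torus.
by move=> x y [z [/sub <- /sub]].
Qed.

(** [redGL] and [secGL] induce mutually inverse maps: each composite moves a
    flag inside its T-orbit, respectively fixes it. *)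
Lemma iso_of_semistable_generic : exists Psi : Q -> GLmod Bn, isomorphism Psi.
Proof.
have [Phi PhiE mPhi] := red_map_exists.
have [Psi PsiE] := quot_lift (orbit_closure_eq PhiE mPhi.1).
exists Psi; split.
  apply: quot_morphism.
  by rewrite (_ : Psi \o _ = Phi) //; apply/funext.
have sss h : ss (pi (secGL P h)) by apply/ssP; exact: generic_secGL.
pose xi h : X := exist _ (pi (secGL P h)) (mem_set (sss h)).
have mxi : @morphism k (GL_fspace k n) X xi.
  apply: (@morphism_to_open _ _ _ _ xi (pi \o secGL P)) => //.
    apply/quot_open/open_GL.
    suff -> : quot_proj _ @^-1` ss = generic P by exact: generic_open.
    by apply/seteqP; split => g /=; rewrite -[quot_proj _]/pi ssP.
  apply: (@comp_morphism k (GL_fspace k n) (GL_fspace k (n + 1)) (GLmod B)).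
    exact: (polymap_morphism (@polymap_secmap k n P)).
  exact: quot_proj_morphism.
have [G GE] : exists G : GLmod Bn -> Q, forall h, G (pin h) = q (xi h).
  apply: quot_lift => h _ [b Bb ->]; congr (q _); apply: val_inj => /=.
  by rewrite secGL_borel.
exists G; split.
- apply: quot_morphism; rewrite (_ : G \o _ = q \o xi); last exact/funext.
  by apply: comp_morphism mxi _; exact: quot_proj_morphism.
- move=> z; have [x <-] := quot_proj_surj z.
  have [g gx gg] := X_repr x.
  rewrite PsiE (PhiE _ _ gx) GE.
  have [t Tt tE] := secGL_redGL gg.
  apply/esym/quot_proj_rel; exists (xi (redGL P g)).
  split; apply: subset_closure.
    by exists t, g; split => //=.
  exists (oneGL k (n + 1)), (secGL P (redGL P g)).
  split => //=; last by rewrite mul1GL.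
  split; first by rewrite det1.
  by rewrite in_basis1 scalar_mx_is_diag.
- move=> w; have [h <-] := GLmod_pi_surj w.
  by rewrite GE PsiE (PhiE (secGL P h)) // redGL_secGL.
Qed.

End Iso.

Theorem theorem5p2 (k : closedFieldType) (n : nat) (P : GL k (n + 1))
    (m : 'I_n -> nat) (n_gt0 : (0 < n)%N) (chi : 'rV[int]_(n + 1))
    (chiE : chi = \sum_(i < n) simple_root i *+ m i)
    (chi_reg : regular_dominant chi)
    (m_incr : forall i j : 'I_n, nat_of_ord j = i.+1 -> (m i < m j)%N) :
  exists Psi : git_quotient (torus P) (borel P) (character P chi) ->
               GLmod (borel_n P),
    isomorphism Psi.
Proof.
have [l [chil l_gt0 l_noninc ln chi_last]] :=
  weight_shape n_gt0 chiE chi_reg m_incr.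
apply: iso_of_semistable_generic => g; exact: semistableP chil _ _ _ _ g.
Qed.
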